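(* The fully discrete compact difference scheme for the plate problem described in the context, with solution $\{U_{ij}^n\},\{V_{ij}^n\}$, satisfies the energy dissipative property $$0\le\check{\mathbf E}^n\le\check{\mathbf E}^0,\qquad1\le n\le N,$$ where $$\check{\mathbf E}^n:=\sqrt{\|\mathcal H\delta_tU^{n+1}\|^2+\tfrac12\left(\|\mathcal HV^{n+1}\|^2+\|\mathcal HV^n\|^2\right)}.$$
   Context: Plate problem, on $\Gamma=(0,1)^2$, $\mathbf x=(x,y)$: $$\partial_t^2u+\hat q(t)\partial_tu+\Delta^2u=f(\mathbf x,t),\quad(\mathbf x,t)\in\Gamma\times(0,T],\qquad\hat q(t)=P\Big(\int_\Gamma|\Delta u(\mathbf x,t)|^2d\mathbf x\Big),$$ $u(\mathbf x,0)=u_0(\mathbf x)$, $\partial_tu(\mathbf x,0)=u_1(\mathbf x)$ for $\mathbf x\in\Gamma$, and $u=\Delta u=0$ on $\partial\Gamma\times(0,T]$; $u_0,u_1,f$ are given functions, and $v=\Delta u$. $\mathcal Q$ denotes a generic positive constant independent of the mesh sizes, possibly different in different places. Standing assumptions on $P:\mathbb R^+\to(0,\infty)$: (i) there are positive constants $p_0,p_1$ such that $P(z)\le p_1$ for $0\le z\le\mathcal Q$ and $P(z)\ge p_0$ for all $z\ge0$; (ii) $P$ is continuously differentiable with $0\le P'(z)\le L$ for $z\ge0$, where $L$ is the Lipschitz constant. Standing regularity assumption: $|\partial_t^4u|,|\partial_t^3\partial_k^2u|,|\partial_k^6u|,|\partial_t\partial_k^4u|\le\mathcal Q$ on $[0,1]^2\times[0,T]$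 for $k=x,y$. Grid: $J_1,J_2$ positive integers, $h_1=\frac1{2J_1}$, $h_2=\frac1{2J_2}$, $x_i=ih_1$ $(0\le i\le2J_1)$, $y_j=jh_2$ $(0\le j\le2J_2)$; $t_n=n\tau$, $0\le n\le N+1$, a uniform partition of $[0,T]$ with $\tau=T/(N+1)$. For grid functions: $\delta_x\delta_{\bar x}U_{ij}=(U_{i+1,j}-2U_{ij}+U_{i-1,j})/h_1^2$, $\delta_y\delta_{\bar y}U_{ij}=(U_{i,j+1}-2U_{ij}+U_{i,j-1})/h_2^2$; $\mathcal AU_{ij}=\frac1{12}(U_{i+1,j}+10U_{ij}+U_{i-1,j})$ for $1\le i\le2J_1-1$ and $\mathcal AU_{ij}=U_{ij}$ for $i=0,2J_1$; $\mathcal BU_{ij}=\frac1{12}(U_{i,j+1}+10U_{ij}+U_{i,j-1})$ for $1\le j\le2J_2-1$ and $\mathcal BU_{ij}=U_{ij}$ for $j=0,2J_2$; $\mathcal H=\mathcal A\mathcal B$, $\Phi=\mathcal B\delta_x\delta_{\bar x}+\mathcal A\delta_y\delta_{\bar y}$; $\delta_tU^n=(U^n-U^{n-1})/\tau$, $\delta_t^{(2)}U^n=(U^{n+1}-2U^n+U^{n-1})/\tau^2$, $\bar\delta_tU^n=(U^{n+1}-U^{n-1})/(2\tau)$, $\widetilde U^n=(U^{n+1}+U^{n-1})/2$. Norms: $\|\omega\|^2=h_1h_2\sum_{i=1}^{2J_1-1}\sum_{j=1}^{2J_2-1}\omega_{ij}^2$, $$\|\omega\|_E=\frac23\sqrt{h_1h_2\sum_{i=1}^{J_1}\sum_{j=1}^{J_2}\left(\omega_{2i-2,2j-1}^2+\omega_{2i-1,2j-2}^2+3\omega_{2i-1,2j-1}^2\right)},\qquad\|\omega\|_F=\sqrt{\tfrac49\|\omega\|^2+\|\omega\|_E^2}.$$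 Fully discrete scheme, for $1\le i\le2J_1-1$, $1\le j\le2J_2-1$, $1\le n\le N$, with $f^n_{ij}=f(x_i,y_j,t_n)$: $$\mathcal H\delta_t^{(2)}U_{ij}^n+P(\|V^n\|_F^2)\,\mathcal H\bar\delta_tU_{ij}^n+\Phi\widetilde V_{ij}^n=\mathcal Hf_{ij}^n,\qquad\mathcal H\bar\delta_tV_{ij}^n=\Phi\bar\delta_tU_{ij}^n,$$ with $U_{ij}^n=V_{ij}^n=0$ at all boundary grid points ($i\in\{0,2J_1\}$ or $j\in\{0,2J_2\}$), $0\le n\le N+1$, and initial data at interior grid points $U_{ij}^0=u_0(x_i,y_j)$, $\delta_tU_{ij}^1=u_1(x_i,y_j)+\frac\tau2u_2(x_i,y_j)$, where $u_2=\partial_t^2u(\cdot,0)=-\hat q(0)u_1-\Delta^2u_0+f(\cdot,0)$; and $V^0=\Delta U^0$, $V^1=\Delta U^1$, that is, $V_{ij}^0=(\Delta u_0)(x_i,y_j)$, $V_{ij}^1=\Delta\big(u_0+\tau u_1+\frac{\tau^2}2u_2\big)(x_i,y_j)$.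
   Formalization: The formal theorem assumes the load f vanishes on [0,1]²×[0,T]; for a general f the claim fails, e.g. u_0=u_1=0 and f=g(t)sin(πx)sin(πy) with g(0)=0, g(t_1)≠0 gives Ě^0=0 but Ě^1>0. *)

(* Defs.v *)
(* MathComp-Analysis, over an arbitrary R : realType. *)
From mathcomp Require Export all_boot all_order all_algebra.
From mathcomp Require Export all_classical all_reals all_analysis.
Export Order.TTheory GRing.Theory Num.Theory.
Export numFieldNormedType.Exports.

Set Implicit Arguments.
Unset Strict Implicit.
Unset Printing Implicit Defensive.

Local Open Scope classical_set_scope.
Local Open Scope ring_scope.

(* Derivative relative to a set A: the difference quotient at x is taken along
   points z of A, z <> x.  On an interval this is the usual derivative at
   interior points and the one-sided derivative at the endpoints, so that the
   values of a total function outside A are irrelevant. *)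
Definition diffq (R : realType) (f : R -> R) (x z : R) : R :=
  (f z - f x) / (z - x).

Definition derivable_in (R : realType) (A : set R) (f : R -> R) (x : R) : Prop :=
  cvg (diffq f x z @[z --> within A x^']).

Definition derive_in (R : realType) (A : set R) (f : R -> R) (x : R) : R :=
  lim (diffq f x z @[z --> within A x^']).

Definition I01 (R : realType) : set R := `[0, 1].
Definition I01o (R : realType) : set R := `]0, 1[.
Arguments I01 {R}.
Arguments I01o {R}.

(* Spatial functions are w x y; space-time functions take time first, u t x y,
   so that u t is the time slice. *)
Definition dx (R : realType) (w : R -> R -> R) (x y : R) : R :=
  derive_in I01 (fun s => w s y) x.
Definition dy (R : realType) (w : R -> R -> R) (x y : R) : R :=
  derive_in I01 (fun s => w x s) y.
Definition dt (R : realType) (T : R) (u : R -> R -> R -> R) (t x y : R) : R :=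
  derive_in `[0, T] (fun s => u s x y) t.

Definition lap (R : realType) (w : R -> R -> R) (x y : R) : R :=
  dx (dx w) x y + dy (dy w) x y.

Inductive var := VX | VY | VT.

Definition pd (R : realType) (T : R) (k : var) (u : R -> R -> R -> R) :
    R -> R -> R -> R :=
  match k with
  | VX => fun t => dx (u t)
  | VY => fun t => dy (u t)
  | VT => dt T u
  end.

(* The head of ks is the outermost derivative. *)
Definition pds (R : realType) (T : R) (ks : seq var) (u : R -> R -> R -> R) :
    R -> R -> R -> R :=
  foldr (pd T) u ks.

Definition pderivable (R : realType) (T : R) (k : var) (u : R -> R -> R -> R)
    (t x y : R) : Prop :=
  match k with
  | VX => derivable_in I01 (fun s => u t s y) x
  | VY => derivable_in I01 (fun s => u t x s) y
  | VT => derivable_in `[0, T] (fun s => u s x y) t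
  end.

(* All the successive partial derivatives of u along ks exist at the points
   (t, x, y) with t in A and x, y in B. *)
Fixpoint pds_exist (R : realType) (T : R) (A B : set R) (ks : seq var)
    (u : R -> R -> R -> R) : Prop :=
  match ks with
  | [::] => True
  | k :: ks' => pds_exist T A B ks' u /\
      forall t x y, A t -> B x -> B y -> pderivable T k (pds T ks' u) t x y
  end.

Definition pds_bounded (R : realType) (T Q : R) (ks : seq var)
    (u : R -> R -> R -> R) : Prop :=
  pds_exist T `[0, T] I01 ks u /\
  forall t x y, 0 <= t <= T -> I01 x -> I01 y -> `|pds T ks u t x y| <= Q.

Definition regular (R : realType) (T : R) (u : R -> R -> R -> R) : Prop :=
  exists2 Q : R, 0 < Q &
    pds_bounded T Q (nseq 4 VT) u /\
    forall k : var, k = VX \/ k = VY ->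
      [/\ pds_bounded T Q [:: VT; VT; VT; k; k] u,
          pds_bounded T Q (nseq 6 k) u &
          pds_bounded T Q (VT :: nseq 4 k) u].

(* P : [0, +oo[ -> ]0, +oo[ is represented by a total function whose values on
   negative arguments are irrelevant.  The generic constant bounding z in the
   upper bound of P is universally quantified. *)
Record damping_coefficient (R : realType) (P : R -> R) : Prop := {
  P_pos : forall z, 0 <= z -> 0 < P z;
  P_upper : forall Q, 0 < Q ->
    exists2 p1 : R, 0 < p1 & forall z, 0 <= z <= Q -> P z <= p1;
  P_lower : exists2 p0 : R, 0 < p0 & forall z, 0 <= z -> p0 <= P z;
  P_derivable : forall z, 0 <= z -> derivable_in `[0, +oo[ P z;
  P_C1 : {within `[0, +oo[, continuous (derive_in `[0, +oo[ P)};
  P_deriv : exists L : R,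
    forall z, 0 <= z -> 0 <= derive_in `[0, +oo[ P z <= L
}.

Definition area (R : realType) :=
  ((@lebesgue_measure R) \x (@lebesgue_measure R))%E.

Arguments area R : clear implicits.

Definition Gamma (R : realType) : set (R * R) := I01o `*` I01o.
Arguments Gamma {R}.

Definition lap_energy (R : realType) (w : R -> R -> R) : R :=
  \int[area R]_(z in Gamma) (`|lap w z.1 z.2| ^+ 2).

Definition lap_square_integrable (R : realType) (w : R -> R -> R) : Prop :=
  (area R).-integrable Gamma (fun z => (`|lap w z.1 z.2| ^+ 2)%:E).

(* The value of d_t^2 u at t = 0 given by the equation. *)
Definition initial_acceleration (R : realType) (P : R -> R)
    (f : R -> R -> R -> R) (u0 u1 : R -> R -> R) (x y : R) : R :=
  - P (lap_energy u0) * u1 x y - lap (lap u0) x y + f 0 x y.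

Record plate_solution (R : realType) (T : R) (P : R -> R)
    (f : R -> R -> R -> R) (u0 u1 : R -> R -> R) (u : R -> R -> R -> R) :
    Prop := {
  plate_dtt : pds_exist T `[0, T] I01o [:: VT; VT] u;
  plate_lap : forall k, k = VX \/ k = VY ->
    pds_exist T `[0, T] I01 [:: k; k] u;
  plate_bilap : forall k, k = VX \/ k = VY ->
    pds_exist T `[0, T] I01o [:: k; k] (fun t => lap (u t));
  plate_integrable : forall t, 0 <= t <= T -> lap_square_integrable (u t);
  plate_eq : forall t x y, 0 < t <= T -> I01o x -> I01o y ->
    pds T [:: VT; VT] u t x y + P (lap_energy (u t)) * dt T u t x y
      + lap (lap (u t)) x y = f t x y;
  plate_init0 : forall x y, I01o x -> I01o y -> u 0 x y = u0 x y;
  plate_init1 : forall x y, I01o x -> I01o y -> dt T u 0 x y = u1 x y;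
  plate_init2 : forall x y, I01o x -> I01o y ->
    pds T [:: VT; VT] u 0 x y = initial_acceleration P f u0 u1 x y;
  plate_bc : forall t x y, 0 < t <= T -> I01 x -> I01 y ->
    ~ (I01o x /\ I01o y) -> u t x y = 0 /\ lap (u t) x y = 0
}.

(* Grid functions are w i j with i <= 2 J1, j <= 2 J2; values at other indices
   are never used.  Grid sequences are U n i j. *)
Definition interior (J1 J2 i j : nat) : bool :=
  (0 < i < 2 * J1)%N && (0 < j < 2 * J2)%N.

Definition on_grid (J1 J2 i j : nat) : bool :=
  (i <= 2 * J1)%N && (j <= 2 * J2)%N.

Definition mesh (R : realType) (J : nat) : R := 1 / (2 * J)%:R.
Arguments mesh R J : clear implicits.

Definition delta_xx (R : realType) (J1 : nat) (w : nat -> nat -> R)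
    (i j : nat) : R :=
  (w i.+1 j - 2 * w i j + w i.-1 j) / mesh R J1 ^+ 2.

Definition delta_yy (R : realType) (J2 : nat) (w : nat -> nat -> R)
    (i j : nat) : R :=
  (w i j.+1 - 2 * w i j + w i j.-1) / mesh R J2 ^+ 2.

Definition opA (R : realType) (J1 : nat) (w : nat -> nat -> R)
    (i j : nat) : R :=
  if (0 < i < 2 * J1)%N then (w i.+1 j + 10 * w i j + w i.-1 j) / 12
  else w i j.

Definition opB (R : realType) (J2 : nat) (w : nat -> nat -> R)
    (i j : nat) : R :=
  if (0 < j < 2 * J2)%N then (w i j.+1 + 10 * w i j + w i j.-1) / 12
  else w i j.

Definition opH (R : realType) (J1 J2 : nat) (w : nat -> nat -> R) :
    nat -> nat -> R :=
  opA J1 (opB J2 w).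

Definition opPhi (R : realType) (J1 J2 : nat) (w : nat -> nat -> R)
    (i j : nat) : R :=
  opB J2 (delta_xx J1 w) i j + opA J1 (delta_yy J2 w) i j.

Definition delta_t (R : realType) (tau : R) (U : nat -> nat -> nat -> R)
    (n i j : nat) : R :=
  (U n i j - U n.-1 i j) / tau.

Definition delta_tt (R : realType) (tau : R) (U : nat -> nat -> nat -> R)
    (n i j : nat) : R :=
  (U n.+1 i j - 2 * U n i j + U n.-1 i j) / tau ^+ 2.

Definition bar_delta_t (R : realType) (tau : R) (U : nat -> nat -> nat -> R)
    (n i j : nat) : R :=
  (U n.+1 i j - U n.-1 i j) / (2 * tau).

Definition time_avg (R : realType) (U : nat -> nat -> nat -> R)
    (n i j : nat) : R :=
  (U n.+1 i j + U n.-1 i j) / 2.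

Definition gnorm (R : realType) (J1 J2 : nat) (w : nat -> nat -> R) : R :=
  Num.sqrt (mesh R J1 * mesh R J2 *
    \sum_(1 <= i < 2 * J1) \sum_(1 <= j < 2 * J2) w i j ^+ 2).

Definition gnormE (R : realType) (J1 J2 : nat) (w : nat -> nat -> R) : R :=
  2 / 3 * Num.sqrt (mesh R J1 * mesh R J2 *
    \sum_(1 <= i < J1.+1) \sum_(1 <= j < J2.+1)
      (w (2 * i - 2)%N (2 * j - 1)%N ^+ 2
       + w (2 * i - 1)%N (2 * j - 2)%N ^+ 2
       + 3 * w (2 * i - 1)%N (2 * j - 1)%N ^+ 2)).

Definition gnormF (R : realType) (J1 J2 : nat) (w : nat -> nat -> R) : R :=
  Num.sqrt (4 / 9 * gnorm J1 J2 w ^+ 2 + gnormE J1 J2 w ^+ 2).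

Definition time_step (R : realType) (T : R) (N : nat) : R := T / N.+1%:R.

Record scheme_solution (R : realType) (T : R) (P : R -> R)
    (f : R -> R -> R -> R) (u0 u1 : R -> R -> R) (J1 J2 N : nat)
    (U V : nat -> nat -> nat -> R) : Prop := {
  scheme_eq1 : forall n i j, (1 <= n <= N)%N -> interior J1 J2 i j ->
    let tau := time_step T N in
    opH J1 J2 (delta_tt tau U n) i j
      + P (gnormF J1 J2 (V n) ^+ 2) * opH J1 J2 (bar_delta_t tau U n) i j
      + opPhi J1 J2 (time_avg V n) i j
    = opH J1 J2
        (fun i' j' => f (n%:R * tau) (i'%:R * mesh R J1) (j'%:R * mesh R J2))
        i j;
  scheme_eq2 : forall n i j, (1 <= n <= N)%N -> interior J1 J2 i j ->
    let tau := time_step T N in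
    opH J1 J2 (bar_delta_t tau V n) i j
    = opPhi J1 J2 (bar_delta_t tau U n) i j;
  scheme_bc : forall n i j, (n <= N.+1)%N ->
    on_grid J1 J2 i j -> ~~ interior J1 J2 i j -> U n i j = 0 /\ V n i j = 0;
  scheme_initU : forall i j, interior J1 J2 i j ->
    let tau := time_step T N in
    let x := i%:R * mesh R J1 in let y := j%:R * mesh R J2 in
    U 0%N i j = u0 x y /\
    delta_t tau U 1%N i j
      = u1 x y + tau / 2 * initial_acceleration P f u0 u1 x y;
  scheme_initV : forall i j, interior J1 J2 i j ->
    let tau := time_step T N in
    let x := i%:R * mesh R J1 in let y := j%:R * mesh R J2 in
    V 0%N i j = lap u0 x y /\
    V 1%N i j = lap (fun x' y' => u0 x' y' + tau * u1 x' y'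
      + tau ^+ 2 / 2 * initial_acceleration P f u0 u1 x' y') x y
}.

Definition energy (R : realType) (T : R) (J1 J2 N : nat)
    (U V : nat -> nat -> nat -> R) (n : nat) : R :=
  Num.sqrt
    (gnorm J1 J2 (opH J1 J2 (delta_t (time_step T N) U n.+1)) ^+ 2
     + 1 / 2 * (gnorm J1 J2 (opH J1 J2 (V n.+1)) ^+ 2
                + gnorm J1 J2 (opH J1 J2 (V n)) ^+ 2)).

(* Main.v *)
Require Import Defs.
From mathcomp Require Import all_boot all_order all_algebra.
From mathcomp Require Import all_classical all_reals all_analysis.
From mathcomp Require Import ring lra zify.
Import Order.TTheory GRing.Theory Num.Theory.
Import numFieldNormedType.Exports.

Local Open Scope classical_set_scope.
Local Open Scope ring_scope.

Set Implicit Arguments.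
Unset Strict Implicit.
Unset Printing Implicit Defensive.

(** With a zero source, the energy is nonincreasing because the scheme admits
    the discrete analogue of multiplying the plate equation by [u_t].  Pair the
    first equation at level [n] with [H (bar_delta_t U^n)].  Since
    [tau * delta_tt U^n] and [bar_delta_t U^n] are the difference and the mean
    of the successive quotients [delta_t U^n] and [delta_t U^(n+1)], the first
    term telescopes into a difference of squared norms of [H delta_t U]; the damping
    term is [P >= 0] times a square.

    What remains is the pairing of [Phi V~] with [H (bar_delta_t U)], where
    [V~] is the time average of [V].  The heart of the proof is that [Phi] can
    be moved from one factor to the other ([opPhi_opH_sym]), so that the second
    equation turns it into the pairing of [H V~] with [H (bar_delta_t V)], which
    telescopes as well.  The transfer is legitimate because, on grid functions
    vanishing on the boundary, the compact averages and the second differences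
    are tridiagonal Toeplitz matrices acting on the array of interior values,
    from the left for [x] and from the right for [y].  Such matrices are
    symmetric and all commute, being polynomials in the adjacency matrix of a
    path, so the transfer is the cyclicity of the trace ([mdot_compact_sym]).

    Summing up, [E_(n+1)^2 - E_n^2] equals minus [2 tau P] times the squared
    norm of [H (bar_delta_t U)], at every step ([mdot_energy_step],
    [energy_step]), and the theorem follows by induction on [n]. *)

(** * Tridiagonal Toeplitz matrices *)

(** The second summand is the adjacency matrix of a path with [m] vertices.
    Its entries are sums of two indicators, rather than the indicator of a
    disjunction, so that the upper and the lower diagonal can be summed
    separately. *)
Definition tridiag (R : realType) (m : nat) (a b : R) : 'M[R]_m :=
  a%:M + b *: \matrix_(i, k) ((k == i.+1 :> nat)%:R + (i == k.+1 :> nat)%:R).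

(** The truncated first and last rows of the matrix agree with the three-point
    stencil thanks to the homogeneous boundary values.  The index shift is due
    to the interior nodes being numbered from 1. *)
Lemma tridiagE (R : realType) (m : nat) (a b : R) (w : nat -> R) (i : 'I_m) :
  w 0%N = 0 -> w m.+1 = 0 ->
  \sum_k tridiag m a b i k * w k.+1 = a * w i.+1 + b * (w i.+2 + w i).
Proof.
move=> w0 wm.
have upper : \sum_(k < m) (k == i.+1 :> nat)%:R * w k.+1 = w i.+2.
  have [lt_im | ge_im] := ltnP i.+1 m.
    rewrite (bigD1 (Ordinal lt_im)) //= eqxx mul1r big1 ?addr0 // => k.
    by rewrite -val_eqE /= => /negbTE ->; rewrite mul0r.
  have -> : i.+2 = m.+1 by have := ltn_ord i; lia.
  rewrite wm big1 // => k _.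
  by rewrite (_ : (k == i.+1 :> nat) = false) ?mul0r //; have := ltn_ord k; lia.
have lower : \sum_(k < m) (i == k.+1 :> nat)%:R * w k.+1 = w i.
  have [i0 | i_gt0] := posnP i.
    by rewrite i0 w0 big1 // => k _; rewrite mul0r.
  have lt_im : (i.-1 < m)%N by have := ltn_ord i; lia.
  rewrite (bigD1 (Ordinal lt_im)) //= prednK // eqxx mul1r big1 ?addr0 // => k.
  rewrite -val_eqE /= => ne_k.
  by rewrite (_ : (i == k.+1 :> nat) = false) ?mul0r //; lia.
rewrite -[X in b * (X + _)]upper -[X in b * (_ + X)]lower -big_split mulr_sumr /=.
have -> : a * w i.+1 = \sum_(k < m) (a%:M : 'M[R]_m) i k * w k.+1.
  rewrite (bigD1 i) //= mxE eqxx mulr1n big1 ?addr0 // => k ne_ki.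
  by rewrite mxE eq_sym (negbTE ne_ki) mulr0n mul0r.
rewrite -big_split; apply: eq_bigr => k _ /=.
by rewrite !mxE; ring.
Qed.

Lemma tridiag_tr (R : realType) (m : nat) (a b : R) :
  (tridiag m a b)^T = tridiag m a b.
Proof.
apply/matrixP => i k.
by rewrite !mxE [k == i]eq_sym [(i == k.+1 :> nat)%:R + _]addrC.
Qed.

(** All these matrices are affine in one and the same adjacency matrix. *)
Lemma tridiagC (R : realType) (m : nat) (a b a' b' : R) :
  tridiag m a b *m tridiag m a' b' = tridiag m a' b' *m tridiag m a b.
Proof.
rewrite /tridiag; set S := \matrix_(i, k) _.
rewrite !(mulmxDl, mulmxDr) -!scalar_mxM -!scalemxAl -!scalemxAr.
rewrite !mul_scalar_mx !mul_mx_scalar !scalerA.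
by rewrite [a' * a]mulrC [b' * b]mulrC -!addrA; congr (_ + _); rewrite addrCA.
Qed.

(** * The Frobenius inner product *)

(** The trace form is what makes cyclic permutations of factors available. *)
Definition mdot (R : realType) (m n : nat) (X Y : 'M[R]_(m, n)) : R :=
  \tr (X *m Y^T).

Lemma mdotE (R : realType) (m n : nat) (X Y : 'M[R]_(m, n)) :
  mdot X Y = \sum_i \sum_j X i j * Y i j.
Proof.
by apply: eq_bigr => i _; rewrite mxE; apply: eq_bigr => j _; rewrite mxE.
Qed.

Lemma mdotC (R : realType) (m n : nat) (X Y : 'M[R]_(m, n)) :
  mdot X Y = mdot Y X.
Proof. by rewrite /mdot -mxtrace_tr trmx_mul trmxK. Qed.

Lemma mdotDl (R : realType) (m n : nat) (X Y Z : 'M[R]_(m, n)) :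
  mdot (X + Y) Z = mdot X Z + mdot Y Z.
Proof. by rewrite /mdot mulmxDl mxtraceD. Qed.

Lemma mdotZl (R : realType) (m n : nat) (a : R) (X Z : 'M[R]_(m, n)) :
  mdot (a *: X) Z = a * mdot X Z.
Proof. by rewrite /mdot -scalemxAl mxtraceZ. Qed.

Lemma mdotDr (R : realType) (m n : nat) (X Y Z : 'M[R]_(m, n)) :
  mdot X (Y + Z) = mdot X Y + mdot X Z.
Proof. by rewrite mdotC mdotDl !(mdotC _ X). Qed.

Lemma mdotZr (R : realType) (m n : nat) (a : R) (X Z : 'M[R]_(m, n)) :
  mdot X (a *: Z) = a * mdot X Z.
Proof. by rewrite mdotC mdotZl mdotC. Qed.

Lemma mdot_ge0 (R : realType) (m n : nat) (X : 'M[R]_(m, n)) : 0 <= mdot X X.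
Proof.
by rewrite mdotE; apply: sumr_ge0 => i _; apply: sumr_ge0 => j _;
  rewrite -expr2 sqr_ge0.
Qed.

(** Each summand is settled separately: the symmetric factors acting from the
    left move around the trace and commute with each other, and those acting
    from the right are already adjacent once transposed. *)
Lemma mdot_compact_sym (R : realType) (m n : nat) (A D : 'M[R]_m)
    (B E : 'M[R]_n) (V W : 'M[R]_(m, n)) :
  A^T = A -> B^T = B -> D^T = D -> E^T = E ->
  A *m D = D *m A -> B *m E = E *m B ->
  mdot (D *m V *m B + A *m V *m E) (A *m W *m B) =
  mdot (A *m V *m B) (D *m W *m B + A *m W *m E).
Proof.
move=> At Bt Dt Et AD BE.
rewrite mdotDl [RHS]mdotC mdotDl ![mdot _ (A *m V *m B)]mdotC /mdot.
rewrite !trmx_mul At Bt Dt Et !mulmxA; congr (_ + _).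
  by rewrite mxtrace_mulC [RHS]mxtrace_mulC !mulmxA AD.
by rewrite -[A *m V *m E *m B]mulmxA -BE mulmxA.
Qed.

(** * Matrix form of the compact operators *)

Definition avg_mx (R : realType) (J : nat) : 'M[R]_((2 * J).-1) :=
  tridiag _ (10 / 12) (1 / 12).

Definition diff_mx (R : realType) (J : nat) : 'M[R]_((2 * J).-1) :=
  tridiag _ (- 2 / mesh R J ^+ 2) (1 / mesh R J ^+ 2).

Definition interior_mx (R : realType) (J1 J2 : nat) (w : nat -> nat -> R) :
    'M[R]_((2 * J1).-1, (2 * J2).-1) :=
  \matrix_(i, j) w i.+1 j.+1.

Definition vanishes (R : realType) (J1 J2 : nat) (w : nat -> nat -> R) : Prop :=
  forall i j, on_grid J1 J2 i j -> ~~ Defs.interior J1 J2 i j -> w i j = 0.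

Lemma vanishes_sides (R : realType) (J1 J2 : nat) (w : nat -> nat -> R) :
  vanishes J1 J2 w ->
  [/\ forall j, (j <= 2 * J2)%N -> w 0%N j = 0,
      forall j, (j <= 2 * J2)%N -> w (2 * J1)%N j = 0,
      forall i, (i <= 2 * J1)%N -> w i 0%N = 0 &
      forall i, (i <= 2 * J1)%N -> w i (2 * J2)%N = 0].
Proof.
by move=> w0; split=> k hk; apply: w0; rewrite /on_grid /Defs.interior; lia.
Qed.

Section Grid.
Variables (R : realType) (J1 J2 : nat).
Hypotheses (J1_gt0 : (0 < J1)%N) (J2_gt0 : (0 < J2)%N).
Implicit Types w : nat -> nat -> R.

Lemma interior_ord (i : 'I_((2 * J1).-1)) (j : 'I_((2 * J2).-1)) :
  Defs.interior J1 J2 i.+1 j.+1.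
Proof. by rewrite /Defs.interior; have := ltn_ord i; have := ltn_ord j; lia. Qed.

Lemma opA_avg_mx w (i : 'I_((2 * J1).-1)) j :
  w 0%N j = 0 -> w (2 * J1)%N j = 0 ->
  opA J1 w i.+1 j = \sum_k avg_mx R J1 i k * w k.+1 j.
Proof.
move=> w0 w1; rewrite (@tridiagE _ _ _ _ (w ^~ j)) // ?prednK ?muln_gt0 //.
by rewrite /opA ifT /=; [ring | have := ltn_ord i; lia].
Qed.

Lemma opB_avg_mx w i (j : 'I_((2 * J2).-1)) :
  w i 0%N = 0 -> w i (2 * J2)%N = 0 ->
  opB J2 w i j.+1 = \sum_(k < (2 * J2).-1) w i k.+1 * avg_mx R J2 k j.
Proof.
move=> w0 w1.
under eq_bigr do rewrite mulrC -[avg_mx R J2]tridiag_tr mxE.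
rewrite (@tridiagE _ _ _ _ (w i)) // ?prednK ?muln_gt0 //.
by rewrite /opB ifT /=; [ring | have := ltn_ord j; lia].
Qed.

Lemma delta_xx_diff_mx w (i : 'I_((2 * J1).-1)) j :
  w 0%N j = 0 -> w (2 * J1)%N j = 0 ->
  delta_xx J1 w i.+1 j = \sum_k diff_mx R J1 i k * w k.+1 j.
Proof.
move=> w0 w1; rewrite (@tridiagE _ _ _ _ (w ^~ j)) // ?prednK ?muln_gt0 //.
by rewrite /delta_xx /=; ring.
Qed.

Lemma delta_yy_diff_mx w i (j : 'I_((2 * J2).-1)) :
  w i 0%N = 0 -> w i (2 * J2)%N = 0 ->
  delta_yy J2 w i j.+1 = \sum_(k < (2 * J2).-1) w i k.+1 * diff_mx R J2 k j.
Proof.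
move=> w0 w1.
under eq_bigr do rewrite mulrC -[diff_mx R J2]tridiag_tr mxE.
rewrite (@tridiagE _ _ _ _ (w i)) // ?prednK ?muln_gt0 //.
by rewrite /delta_yy /=; ring.
Qed.

(** The outer average in [x] also reads the inner average on the sides [i = 0]
    and [i = 2 J1]; it is zero there, which is why the matrix of the interior
    rows suffices. *)
Lemma interior_mx_opH w : vanishes J1 J2 w ->
  interior_mx J1 J2 (opH J1 J2 w) =
  avg_mx R J1 *m interior_mx J1 J2 w *m avg_mx R J2.
Proof.
case/vanishes_sides=> wl wr wb wt; rewrite -mulmxA; apply/matrixP => i j.
have ltj := ltn_ord j.
rewrite mxE /opH opA_avg_mx.
- rewrite mxE; apply: eq_bigr => k _; congr (_ * _).
  rewrite opB_avg_mx ?wb ?wt //; try by have := ltn_ord k; lia.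
  by rewrite mxE; apply: eq_bigr => l _; rewrite [interior_mx _ _ _ _ _]mxE.
- by rewrite /opB ifT ?wl; [ring | lia ..].
- by rewrite /opB ifT ?wr; [ring | lia ..].
Qed.

Lemma interior_mx_opPhi w : vanishes J1 J2 w ->
  interior_mx J1 J2 (opPhi J1 J2 w) =
  diff_mx R J1 *m interior_mx J1 J2 w *m avg_mx R J2
  + avg_mx R J1 *m interior_mx J1 J2 w *m diff_mx R J2.
Proof.
case/vanishes_sides=> wl wr wb wt; rewrite -[X in _ + X]mulmxA.
apply/matrixP => i j; rewrite mxE /opPhi [RHS]mxE.
have lti := ltn_ord i.
have ltj := ltn_ord j.
congr (_ + _).
  rewrite opB_avg_mx.
  - rewrite [RHS]mxE; apply: eq_bigr => k _; congr (_ * _).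
    rewrite delta_xx_diff_mx ?wl ?wr //; try by have := ltn_ord k; lia.
    by rewrite mxE; apply: eq_bigr => l _; rewrite [interior_mx _ _ _ _ _]mxE.
  - by rewrite /delta_xx ?wb; [ring | lia ..].
  - by rewrite /delta_xx ?wt; [ring | lia ..].
rewrite opA_avg_mx.
- rewrite [RHS]mxE; apply: eq_bigr => k _; congr (_ * _).
  rewrite delta_yy_diff_mx ?wb ?wt //; try by have := ltn_ord k; lia.
  by rewrite mxE; apply: eq_bigr => l _; rewrite [interior_mx _ _ _ _ _]mxE.
- by rewrite /delta_yy ?wl; [ring | lia ..].
- by rewrite /delta_yy ?wr; [ring | lia ..].
Qed.

(** Discrete Green formula: it transfers [Phi] across the inner product in the
    presence of the averages [H]. *)
Lemma opPhi_opH_sym v w : vanishes J1 J2 v -> vanishes J1 J2 w ->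
  mdot (interior_mx J1 J2 (opPhi J1 J2 v)) (interior_mx J1 J2 (opH J1 J2 w)) =
  mdot (interior_mx J1 J2 (opH J1 J2 v)) (interior_mx J1 J2 (opPhi J1 J2 w)).
Proof.
move=> v0 w0; rewrite !interior_mx_opH // !interior_mx_opPhi //.
by apply: mdot_compact_sym; first [exact: tridiag_tr | exact: tridiagC].
Qed.

Lemma interior_mx_opH_lin (a b : R) z v w :
  (forall i j, z i j = a * v i j + b * w i j) ->
  interior_mx J1 J2 (opH J1 J2 z) =
  a *: interior_mx J1 J2 (opH J1 J2 v) + b *: interior_mx J1 J2 (opH J1 J2 w).
Proof.
move=> zE; apply/matrixP => i j; rewrite !mxE /opH /opA /opB.
by do !case: ifP => _; rewrite !zE; ring.
Qed.

Lemma opH_on_grid0 w i j : Defs.interior J1 J2 i j ->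
  (forall i j, on_grid J1 J2 i j -> w i j = 0) -> opH J1 J2 w i j = 0.
Proof.
rewrite /Defs.interior => ij w0; rewrite /opH /opA /opB.
have {}w0 k l : (k <= i.+1)%N -> (l <= j.+1)%N -> w k l = 0.
  by move=> ki lj; apply: w0; rewrite /on_grid; lia.
by case: ifP => _; case: ifP => _; rewrite !w0 //; try lia; ring.
Qed.

Lemma gnorm_sqr w :
  Defs.gnorm J1 J2 w ^+ 2 =
  mesh R J1 * mesh R J2 * mdot (interior_mx J1 J2 w) (interior_mx J1 J2 w).
Proof.
have -> : mdot (interior_mx J1 J2 w) (interior_mx J1 J2 w) =
    \sum_(1 <= i < 2 * J1) \sum_(1 <= j < 2 * J2) w i j ^+ 2.
  rewrite mdotE big_add1 big_mkord; apply: eq_bigr => i _.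
  by rewrite big_add1 big_mkord; apply: eq_bigr => j _; rewrite !mxE expr2.
rewrite sqr_sqrtr // !mulr_ge0 // ?divr_ge0 //.
by do 2!(apply: sumr_ge0 => ? _); exact: sqr_ge0.
Qed.

End Grid.

(** * Energy decay *)

(** One time step in matrix form.  Here [X] and [X'] stand for [H delta_t U] at
    two consecutive levels, [Y] and [Y'] for [H V] two levels apart, [G] for
    [Phi] applied to the average of [V], and [p] for the damping.  The last
    hypothesis is the discrete Green formula combined with the second equation
    of the scheme. *)
Lemma mdot_energy_step (R : realType) (m n : nat) (tau p : R)
    (X' X Y' Y G : 'M[R]_(m, n)) :
  0 < tau -> 0 <= p ->
  tau^-1 *: (X' - X) + (p / 2) *: (X' + X) + G = 0 ->
  mdot G (2^-1 *: (X' + X)) = mdot (2^-1 *: (Y' + Y)) ((2 * tau)^-1 *: (Y' - Y)) ->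
  mdot X' X' + 1 / 2 * mdot Y' Y' <= mdot X X + 1 / 2 * mdot Y Y.
Proof.
move=> tau_gt0 p_ge0 scheme.
have := mdot_ge0 (X' + X).
have: mdot (tau^-1 *: (X' - X) + (p / 2) *: (X' + X) + G) (2^-1 *: (X' + X)) = 0.
  by rewrite scheme -[0](scale0r 0) mdotZl mul0r.
rewrite -(scaleN1r X) -(scaleN1r Y) => balance sq_ge0 symm; move: balance sq_ge0.
rewrite [mdot _ (2^-1 *: _)]mdotDl {}symm !(mdotDl, mdotDr, mdotZl, mdotZr).
rewrite [mdot X X']mdotC [mdot Y Y']mdotC.
set x' := mdot X' X'; set x := mdot X X; set xx := mdot X' X.
set y' := mdot Y' Y'; set y := mdot Y Y; set yy := mdot Y' Y.
move=> balance sq_ge0.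
have e : (x' + 1 / 2 * y') - (x + 1 / 2 * y) =
    - (tau * p / 2 * (x' + xx + (xx + x))).
  (* Up to the factor 2 tau, this is the equation tested with (X' + X) / 2. *)
  apply/eqP; rewrite -subr_eq0; apply/eqP.
  by rewrite -[RHS](mulr0 (2 * tau)) -balance; field; rewrite gt_eqF.
by rewrite -subr_le0 e oppr_le0 mulr_ge0 // divr_ge0 // mulr_ge0 // ltW.
Qed.

Section Decay.
Variables (R : realType) (T : R) (P : R -> R) (f : R -> R -> R -> R).
Variables (u0 u1 : R -> R -> R) (J1 J2 N : nat) (U V : nat -> nat -> nat -> R).
Hypotheses (T_gt0 : 0 < T) (P_gt0 : forall z, 0 <= z -> 0 < P z).
Hypothesis f0 : forall t x y, 0 <= t <= T -> I01 x -> I01 y -> f t x y = 0.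
Hypotheses (J1_gt0 : (0 < J1)%N) (J2_gt0 : (0 < J2)%N).
Hypothesis UV : scheme_solution T P f u0 u1 J1 J2 N U V.

Let tau := time_step T N.
Let HM (w : nat -> nat -> R) := interior_mx J1 J2 (opH J1 J2 w).
Let PhiM (w : nat -> nat -> R) := interior_mx J1 J2 (opPhi J1 J2 w).

Lemma tau_gt0 : 0 < tau.
Proof. by rewrite divr_gt0. Qed.

Lemma mesh_node (J k : nat) : (0 < J)%N -> (k <= 2 * J)%N ->
  I01 (k%:R * mesh R J).
Proof.
move=> J_gt0 le_k; rewrite /I01 /mkset /= in_itv /= /mesh mulrA mulr1.
by rewrite divr_ge0 //= ler_pdivrMr ?mul1r ?ler_nat // ltr0n; lia.
Qed.

Lemma opH_source_eq0 n i j : (n <= N)%N -> Defs.interior J1 J2 i j ->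
  opH J1 J2 (fun i' j' => f (n%:R * tau) (i'%:R * mesh R J1) (j'%:R * mesh R J2))
    i j = 0.
Proof.
move=> le_nN int_ij; apply: opH_on_grid0 => // k l /andP[le_k le_l].
apply: f0; [|exact: mesh_node..].
rewrite mulr_ge0 ?(ltW tau_gt0) //= /tau /time_step mulrA ler_pdivrMr //.
by rewrite mulrC ler_wpM2l ?ler_nat ?leqW // ltW.
Qed.

Lemma energyE n : energy T J1 J2 N U V n =
  Num.sqrt (mesh R J1 * mesh R J2 *
    (mdot (HM (delta_t tau U n.+1)) (HM (delta_t tau U n.+1)) +
     1 / 2 * (mdot (HM (V n.+1)) (HM (V n.+1)) + mdot (HM (V n)) (HM (V n))))).
Proof. by rewrite /energy !gnorm_sqr //; congr Num.sqrt; rewrite /HM /tau; ring. Qed.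

(** The stencil at level [n.+1] involves the levels [n], [n.+1] and [n.+2], and
    these are exactly the levels occurring in the two energies compared. *)
Lemma energy_step n : (n < N)%N ->
  energy T J1 J2 N U V n.+1 <= energy T J1 J2 N U V n.
Proof.
move=> lt_nN.
have tau_neq0 : tau != 0 by rewrite gt_eqF ?tau_gt0.
have U0 k : (k <= N.+1)%N -> vanishes J1 J2 (U k).
  by move=> le_k i j on bd; case: (scheme_bc UV le_k on bd).
have V0 k : (k <= N.+1)%N -> vanishes J1 J2 (V k).
  by move=> le_k i j on bd; case: (scheme_bc UV le_k on bd).
have Ubar0 : vanishes J1 J2 (bar_delta_t tau U n.+1).
  by move=> i j on bd; rewrite /bar_delta_t !U0 //= ?subrr ?mul0r //; lia.
have Vavg0 : vanishes J1 J2 (time_avg V n.+1).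
  by move=> i j on bd; rewrite /time_avg !V0 //= ?addr0 ?mul0r //; lia.
set X' := HM (delta_t tau U n.+2); set X := HM (delta_t tau U n.+1).
set Y' := HM (V n.+2); set Y := HM (V n).
have Utt : HM (delta_tt tau U n.+1) = tau^-1 *: (X' - X).
  rewrite scalerBr -scaleNr; apply: interior_mx_opH_lin => i j.
  by rewrite /delta_tt /delta_t /=; field.
have Ubar : HM (bar_delta_t tau U n.+1) = 2^-1 *: (X' + X).
  rewrite scalerDr; apply: interior_mx_opH_lin => i j.
  by rewrite /bar_delta_t /delta_t /=; field.
have Vavg : HM (time_avg V n.+1) = 2^-1 *: (Y' + Y).
  rewrite scalerDr; apply: interior_mx_opH_lin => i j.
  by rewrite /time_avg /=; field.
have Vbar : HM (bar_delta_t tau V n.+1) = (2 * tau)^-1 *: (Y' - Y).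
  rewrite scalerBr -scaleNr; apply: interior_mx_opH_lin => i j.
  by rewrite /bar_delta_t /=; field.
set p := P (gnormF J1 J2 (V n.+1) ^+ 2).
have decay : mdot X' X' + 1 / 2 * mdot Y' Y' <= mdot X X + 1 / 2 * mdot Y Y.
  apply: (@mdot_energy_step _ _ _ tau p _ _ _ _ (PhiM (time_avg V n.+1))).
  - exact: tau_gt0.
  - by rewrite ltW // P_gt0 // sqr_ge0.
  - rewrite -scalerA -Ubar -Utt; apply/matrixP => i j.
    have ij := interior_ord J1_gt0 J2_gt0 i j.
    have := @scheme_eq1 _ _ _ _ _ _ _ _ _ _ _ UV n.+1 _ _ lt_nN ij.
    by rewrite /= -/tau opH_source_eq0 // !mxE.
  - rewrite -Ubar -Vavg -Vbar opPhi_opH_sym //; congr mdot; apply/matrixP => i j.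
    have ij := interior_ord J1_gt0 J2_gt0 i j.
    by rewrite !mxE; apply/esym; apply: (scheme_eq2 UV).
(* The squared norm of H V at level n+1 occurs in both energies and cancels. *)
rewrite !energyE ler_wsqrtr // ler_wpM2l ?mulr_ge0 ?divr_ge0 //.
by rewrite -/X' -/X -/Y' -/Y; lra.
Qed.

End Decay.

Unset Implicit Arguments.

Theorem corollary4p3p1 (R : realType) (T : R) (P : R -> R)
    (f : R -> R -> R -> R) (u0 u1 : R -> R -> R) (u : R -> R -> R -> R)
    (J1 J2 N : nat) (U V : nat -> nat -> nat -> R) :
  0 < T ->
  damping_coefficient P ->
  plate_solution T P f u0 u1 u ->
  regular T u ->
  (forall t x y, 0 <= t <= T -> I01 x -> I01 y -> f t x y = 0) ->
  (0 < J1)%N -> (0 < J2)%N ->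
  scheme_solution T P f u0 u1 J1 J2 N U V ->
  forall n : nat, (1 <= n <= N)%N ->
    0 <= energy T J1 J2 N U V n <= energy T J1 J2 N U V 0.
Proof.
move=> T_gt0 P_damp _ _ f0 J1_gt0 J2_gt0 UV n /andP[_ le_nN].
rewrite sqrtr_ge0 /=; elim: n le_nN => [//|n IHn lt_nN].
apply: le_trans (IHn (ltnW lt_nN)).
exact: (energy_step T_gt0 (P_pos P_damp) f0 J1_gt0 J2_gt0 UV lt_nN).
Qed.
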